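(* Consider a smooth monotone game with gradient operator $V$ that is $L$-Lipschitz ($L>0$), and let $D=\sup_{\pi,\pi'\in\mathcal{X}}\|\pi-\pi'\|$. Let $T\ge 1$ be the total number of iterations and suppose all players run GABP with full feedback from an arbitrary initial strategy profile $\pi^1\in\mathcal{X}$, with constant perturbation strength $\mu>0$, constant learning rate $\eta_t=\eta\in\left(0,\frac{\mu}{(L+\mu)^2}\right)$, and update interval $T_\sigma=c\cdot\max\left(1,\frac{6\ln(3(T+1))}{\ln(1+\eta\mu)}\right)$ for some constant $c\ge 1$ (such that $T_\sigma$ is an integer). Then for every $t\in\{1,\dots,T\}$, $$\mathrm{GAP}(\pi^{t+1})\le D\cdot r^{\mathrm{tan}}(\pi^{t+1})\le \frac{17\,c\,D^2\left(\frac{6\ln(3(T+1))}{\ln(1+\eta\mu)}+1\right)}{t}\left(\mu+\frac{1+\eta L}{\eta}\right).$$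
   Context: Game. There are $N$ players; player $i\in[N]=\{1,\dots,N\}$ has a nonempty compact convex strategy space $\mathcal{X}_i\subset\mathbb{R}^{d_i}$, and $\mathcal{X}=\prod_{i\in[N]}\mathcal{X}_i$. Player $i$ has a payoff function $v_i:\mathcal{X}\to\mathbb{R}$, differentiable on $\mathcal{X}$, which she wants to maximize. Let $V(\pi)=(\nabla_{\pi_i}v_i(\pi))_{i\in[N]}$. The norm $\|\cdot\|$ is the $\ell_2$-norm. The game is smooth monotone: for all $\pi,\pi'\in\mathcal{X}$, $\langle V(\pi)-V(\pi'),\pi-\pi'\rangle\le 0$ and $\|V(\pi)-V(\pi')\|\le L\|\pi-\pi'\|$. Measures. $\mathrm{GAP}(\pi)=\max_{\tilde\pi\in\mathcal{X}}\langle V(\pi),\tilde\pi-\pi\rangle$ and $r^{\mathrm{tan}}(\pi)=\min_{a\in N_{\mathcal{X}}(\pi)}\|-V(\pi)+a\|$, where $N_{\mathcal{X}}(\pi)=\{a\in\prod_{i}\mathbb{R}^{d_i} : \langle a,\pi'-\pi\rangle\le 0\ \forall \pi'\in\mathcal{X}\}$ is the normal cone. GABP (Gradient Ascent with Boosting Payoff Perturbation). Given learning rates $\eta_t>0$, perturbation strength $\mu>0$, a positive integer update interval $T_\sigma$, and initial profile $\pi^1\in\mathcal{X}$, put $k(t)=\lfloor (t-1)/T_\sigma\rfloor+1$ and $\sigma_i^{k}=\pi_i^{T_\sigma(k-1)+1}$ for $k\ge1$ (so $\sigma_i^1=\pi_i^1$). For $t\ge 1$, each player $i$ receives feedback $\widehat\nabla_{\pi_i}v_i(\pi^t)$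 and sets $$\pi_i^{t+1}=\arg\max_{x\in\mathcal{X}_i}\left\{\eta_t\left\langle \widehat\nabla_{\pi_i}v_i(\pi^t)-\mu\frac{\sigma_i^{k(t)}-\sigma_i^1}{k(t)+1}-\mu\left(\pi_i^t-\sigma_i^{k(t)}\right),x\right\rangle-\frac12\|x-\pi_i^t\|^2\right\}.$$ Full feedback means $\widehat\nabla_{\pi_i}v_i(\pi^t)=\nabla_{\pi_i}v_i(\pi^t)$. *)

(* Defs.v *)
From HB Require Import structures.
From mathcomp Require Import all_boot all_order all_algebra.
From mathcomp Require Import all_classical all_reals all_analysis.
Set Implicit Arguments.
Unset Strict Implicit.
Unset Printing Implicit Defensive.
Import Order.TTheory GRing.Theory Num.Theory.
Import numFieldNormedType.Exports.
Local Open Scope classical_set_scope.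
Local Open Scope ring_scope.

(* A strategy profile is one row vector of length \sum_i d i; the strategy of
   player i is its i-th block, submxrow p i. The library norm of 'rV[R]_n is the
   sup norm, so the Euclidean norm is defined separately; the two induce the
   same topology. *)

Section Euclidean.
Context {R : realType} {n : nat}.
Implicit Types (x y p a g : 'rV[R]_n) (X : set 'rV[R]_n)
  (V : 'rV[R]_n -> 'rV[R]_n).

Definition dot x y : R := \sum_(j < n) x 0 j * y 0 j.

Definition norm2 x : R := Num.sqrt (dot x x).

Definition diameter X : R :=
  sup [set r | exists x y, [/\ X x, X y & r = norm2 (x - y)]].

Definition normal_cone X p : set 'rV[R]_n :=
  [set a | forall p', X p' -> dot a (p' - p) <= 0].

(* The supremum is a maximum when X is nonempty and compact. *)
Definition gap X V p : R := sup [set dot (V p) (p' - p) | p' in X].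

(* The infimum is a minimum: the normal cone is closed and contains 0. *)
Definition rtan X V p : R := inf [set norm2 (- V p + a) | a in normal_cone X p].

Definition monotone_game X V : Prop :=
  forall p p', X p -> X p' -> dot (V p - V p') (p - p') <= 0.

Definition smooth_game X V (L : R) : Prop :=
  forall p p', X p -> X p' -> norm2 (V p - V p') <= L * norm2 (p - p').

(* First-order expansion of f at p along X. As f matters only on X, nothing is
   asked of it off X; g is unique when X has nonempty interior. *)
Definition gradient_at X (f : 'rV[R]_n -> R) p g : Prop :=
  (fun y => f y - f p - dot g (y - p)) =o_ (within X (nbhs p)) (fun y => y - p).

Definition argmax X (f : 'rV[R]_n -> R) : set 'rV[R]_n :=
  [set x | X x /\ forall y, X y -> f y <= f x].

End Euclidean.

Section Game.
Context {R : realType} {N : nat} {d : 'I_N -> nat}.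
Local Notation profile := 'rV[R]_(\sum_i d i).
Implicit Types (X : forall i, set 'rV[R]_(d i)) (v : 'I_N -> profile -> R)
  (V : profile -> profile) (p : nat -> profile).

Definition profiles X : set profile := [set q | forall i, X i (submxrow q i)].

(* Each v i is differentiable on the product set, and block i of V is the block
   of its gradient in the strategy of player i. *)
Definition gradient_operator X v V : Prop :=
  forall q, profiles X q -> forall i,
    exists2 g : profile, gradient_at (profiles X) (v i) q g
      & submxrow (V q) i = submxrow g i.

Definition phase (Ts t : nat) : nat := ((t - 1) %/ Ts + 1)%N.

Definition anchor (Ts : nat) p (k : nat) : profile := p (Ts * (k - 1) + 1)%N.

(* Iterates are indexed from 1, so p 0 is irrelevant; fb t is the feedback
   received at iteration t, and iterations 1, ..., T are run. *)
Definition gabp X (eta : nat -> R) (mu : R) (Ts T : nat)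
    (fb : nat -> profile) p : Prop :=
  profiles X (p 1%N) /\
  forall t, (1 <= t <= T)%N -> forall i : 'I_N,
    let k := phase Ts t in
    let sk := submxrow (anchor Ts p k) i in
    let s1 := submxrow (anchor Ts p 1) i in
    let pt := submxrow (p t) i in
    argmax (X i)
      (fun x =>
         eta t * dot (submxrow (fb t) i
                      - (mu / k.+1%:R) *: (sk - s1) - mu *: (pt - sk)) x
         - 2^-1 * norm2 (x - pt) ^+ 2)
      (submxrow (p t.+1) i).

End Game.

(* Main.v *)
Require Import Defs.
From mathcomp Require Import all_boot all_order all_algebra.
From mathcomp Require Import all_classical all_reals all_analysis.
From mathcomp Require Import ring lra zify.
Import Order.TTheory GRing.Theory Num.Theory.
Import numFieldNormedType.Exports.
Local Open Scope classical_set_scope.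
Local Open Scope ring_scope.

(* Write x_k for the k-th anchor and s_k = (k x_k + x_1) / (k + 1). During
   phase k the iteration is projected gradient ascent for the operator
   V - mu (id - s_k), whose step is a contraction of squared factor
   1 - eta mu; its fixed point z_k is the resolvent of - V / mu at s_k. The
   length of a phase makes |x_{k+1} - z_k| <= D / (3 (T + 1))^3, so the anchors
   follow Halpern's iteration x_{k+1} = J s_k up to negligible errors. With
   g_k = s_k - z_k, the potential
     (k + 1)^2 / 2 |g_k|^2 + (k + 1) <g_k, z_k - x_1>
   vanishes at k = 1 and decreases up to the errors, by monotonicity between
   z_k and z_{k+1}; hence |g_k| = O(D / k), and all distances between s_k, x_k,
   z_k and the iterates of phase k are O(D / k). The optimality condition of
   the last step exhibits an explicit normal vector, which bounds the tangent
   residual by these distances. *)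

(** * Euclidean inner product, norm and first-order optimality *)

Section EuclideanTheory.
Context {R : realType} {n : nat}.
Implicit Types (x y z a b u w q : 'rV[R]_n) (X : set 'rV[R]_n).

Lemma dotC x y : dot x y = dot y x.
Proof. by apply: eq_bigr => j _; rewrite mulrC. Qed.

Lemma dotDl x y z : dot (x + y) z = dot x z + dot y z.
Proof. by rewrite -big_split; apply: eq_bigr => j _; rewrite mxE mulrDl. Qed.

Lemma dotZl (k : R) x y : dot (k *: x) y = k * dot x y.
Proof. by rewrite mulr_sumr; apply: eq_bigr => j _; rewrite mxE mulrA. Qed.

Lemma dotNl x y : dot (- x) y = - dot x y.
Proof. by rewrite -scaleN1r dotZl mulN1r. Qed.

Lemma dotDr x y z : dot z (x + y) = dot z x + dot z y.
Proof. by rewrite !(dotC z) dotDl. Qed.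

Lemma dotZr (k : R) x y : dot y (k *: x) = k * dot y x.
Proof. by rewrite !(dotC y) dotZl. Qed.

Lemma dotNr x y : dot y (- x) = - dot y x.
Proof. by rewrite !(dotC y) dotNl. Qed.

Definition dotE := (dotDl, dotDr, dotNl, dotNr, dotZl, dotZr).

Lemma dot_ge0 x : 0 <= dot x x.
Proof. by apply: sumr_ge0 => j _; rewrite -expr2 sqr_ge0. Qed.

Lemma norm2_ge0 x : 0 <= norm2 x.
Proof. exact: sqrtr_ge0. Qed.

Lemma sqr_norm2 x : norm2 x ^+ 2 = dot x x.
Proof. by rewrite sqr_sqrtr ?dot_ge0. Qed.

Lemma norm2N x : norm2 (- x) = norm2 x.
Proof. by rewrite /norm2 !dotE opprK. Qed.

Lemma norm2C x y : norm2 (x - y) = norm2 (y - x).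
Proof. by rewrite -norm2N opprB. Qed.

Lemma norm2Z (k : R) x : 0 <= k -> norm2 (k *: x) = k * norm2 x.
Proof.
move=> k0; rewrite /norm2 !dotE mulrA -expr2 sqrtrM ?sqr_ge0//.
by rewrite sqrtr_sqr ger0_norm.
Qed.

Lemma norm2_eq0 x : norm2 x = 0 -> x = 0.
Proof.
move=> /(congr1 (fun r => r ^+ 2)); rewrite sqr_norm2 expr0n /= => /eqP.
rewrite psumr_eq0 => [/allP x0|j _]; last by rewrite -expr2 sqr_ge0.
apply/rowP => j; rewrite mxE; have := x0 j (mem_index_enum _).
by rewrite -expr2 sqrf_eq0 => /eqP.
Qed.

Lemma dot_le x y : dot x y <= norm2 x * norm2 y.
Proof.
have [x0|x0] := eqVneq (norm2 x) 0.
  by rewrite x0 (norm2_eq0 _ x0) -(scale0r 0) dotZl !mul0r.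
have [y0|y0] := eqVneq (norm2 y) 0.
  by rewrite y0 (norm2_eq0 _ y0) -(scale0r 0) dotZr mul0r mulr0.
have xy_gt0 : 0 < norm2 x * norm2 y.
  by rewrite mulr_gt0// lt_def ?x0 ?y0 norm2_ge0.
have := dot_ge0 (norm2 y *: x - norm2 x *: y).
rewrite !dotE (dotC y x) -!sqr_norm2 => h; rewrite -(ler_pM2l xy_gt0); lra.
Qed.

Lemma norm2D x y : norm2 (x + y) <= norm2 x + norm2 y.
Proof.
rewrite -(ler_pXn2r (n := 2)) ?nnegrE ?addr_ge0 ?norm2_ge0//.
rewrite sqr_norm2 !dotE (dotC y x) sqrrD !sqr_norm2.
have := dot_le x y; lra.
Qed.

Lemma norm2B_trans x y z : norm2 (x - z) <= norm2 (x - y) + norm2 (y - z).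
Proof. by rewrite -[x - z](subrKA y) norm2D. Qed.

Lemma mx_norm_coord x j : `|x 0 j| <= `|x|.
Proof.
rewrite [leRHS]mx_normrE.
exact: (le_bigmax _ (fun ij => `|x ij.1 ij.2|) (0, j)).
Qed.

Lemma mx_norm_le x (M : R) :
  0 <= M -> (forall j, `|x 0 j| <= M) -> `|x| <= M.
Proof.
move=> M0 xM; rewrite [leLHS]mx_normrE; apply: bigmax_le => // -[i j] _ /=.
by rewrite (ord1 i).
Qed.

(** The crude factor [n] is enough, since the bound only serves to carry continuity and boundedness
    from the sup norm to the Euclidean norm. *)
Lemma norm2_le_mx_norm x : norm2 x <= n%:R * `|x|.
Proof.
rewrite -(ler_pXn2r (n := 2)) ?nnegrE ?norm2_ge0 ?mulr_ge0//.
rewrite sqr_norm2 exprMn.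
have coord j : x 0 j * x 0 j <= `|x| ^+ 2.
  by rewrite -expr2 -real_normK ?num_real// ler_sqr ?nnegrE// mx_norm_coord.
apply: (@le_trans _ _ (n%:R * `|x| ^+ 2)).
  have -> : n%:R * `|x| ^+ 2 = \sum_(j < n) `|x| ^+ 2.
    by rewrite sumr_const card_ord mulr_natl.
  exact: ler_sum.
rewrite ler_wpM2r ?sqr_ge0// -natrX ler_nat.
by rewrite -mulnn; case: (n) => // k; rewrite leq_pmulr.
Qed.

Lemma near_mx_norm_lt x (e : R) : 0 < e -> \forall y \near x, `|x - y| < e.
Proof.
by move=> e0; apply: (@cvgr_dist_lt _ 'rV[R]_n _ (nbhs x) _ id x) e e0;
  exact: cvg_id.
Qed.

Lemma lipschitz_within_continuous X (f : 'rV[R]_n -> R) (k : R) :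
  (forall x y, X x -> X y -> f x - f y <= k * norm2 (x - y)) ->
  {within X, continuous f}.
Proof.
move=> f_lip; apply/subspace_continuousP => x Xx.
(* The added 1 keeps [K] positive, so that [e / K] is a valid radius even when [k] or [n] is
   zero. *)
pose K := `|k| * n%:R + 1.
have K0 : 0 < K by rewrite ltr_wpDl// mulr_ge0.
have bound y : X y -> `|f x - f y| <= K * `|x - y|.
  move=> Xy; have kn u : k * norm2 u <= K * `|u|.
    rewrite mulrDl mul1r -mulrA ler_wpDr//.
    apply: le_trans (ler_wpM2r (norm2_ge0 u) (ler_norm k)) _.
    by rewrite ler_wpM2l// norm2_le_mx_norm.
  rewrite ler_norml lerNl opprB.
  by rewrite (le_trans (f_lip y x _ _)) ?(le_trans (f_lip x y _ _))// norm2C.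
apply/cvgrPdist_lt => e e0; rewrite near_withinE.
near=> y => Xy; apply: le_lt_trans (bound y Xy) _.
rewrite mulrC -ltr_pdivlMr//.
near: y; apply: near_mx_norm_lt.
by rewrite divr_gt0.
Unshelve. all: by end_near. Qed.

Lemma convex_segment X x y (s : R) : convex_set X -> X x -> X y ->
  0 <= s <= 1 -> X (x + s *: (y - x)).
Proof.
move=> Xcvx Xx Xy /andP[s0 s1].
have /set_mem := Xcvx y x (Itv01 s0 s1) (mem_set Xy) (mem_set Xx).
congr X; rewrite /conv/= /unstable.onem scalerBr scalerBl scale1r.
by rewrite addrC -addrA (addrC (- _)).
Qed.

(** First-order optimality: moving from [x] a fraction [s] of the way to [y] changes the objective
    by [s A - s^2 B / 2], where [A] is the inner product of the conclusion and [B = |y - x|^2]. If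
    [A] were positive, a small [s] would improve on the maximum. *)
Lemma argmax_quadratic X (eta : R) w q x : convex_set X ->
  argmax X (fun y => eta * dot w y - 2^-1 * norm2 (y - q) ^+ 2) x ->
  forall y, X y -> dot (q + eta *: w - x) (y - x) <= 0.
Proof.
move=> Xcvx [Xx xmax] y Xy; rewrite leNgt; apply/negP.
set A := dot _ _ => A0; pose B := dot (y - x) (y - x).
have B0 : 0 <= B := dot_ge0 _.
have C0 : 0 < A + B + 1 by lra.
(* This choice gives [s <= 1] and [s B < A], so the gain is positive. *)
pose s := A / (A + B + 1).
have sC : s * (A + B + 1) = A by rewrite mulfVK// gt_eqF.
have s0 : 0 < s by rewrite divr_gt0.
have s1 : s <= 1 by rewrite ler_pdivrMr// mul1r; lra.
have s01 : 0 <= s <= 1 by rewrite ltW.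
have := xmax _ (convex_segment _ _ _ _ Xcvx Xx Xy s01).
rewrite !sqr_norm2 => h.
have {h} : s * (2 * A - s * B) <= 0.
  move: h; rewrite /A /B !dotE (dotC y x) (dotC y q) (dotC x q).
  by move=> h; nra.
rewrite pmulr_rle0// => h; have : s * A > 0 by rewrite mulr_gt0.
nra.
Qed.

End EuclideanTheory.

Lemma nonexpansive_continuous {R : realType} {m n : nat}
    (f : 'rV[R]_m -> 'rV[R]_n) :
  (forall x y : 'rV[R]_m, `|f x - f y| <= `|x - y|) -> continuous f.
Proof.
move=> f_le x; apply/(@cvgrPdist_lt _ _ _ (nbhs x)) => e e0; near=> y.
apply: le_lt_trans (f_le _ _) _.
near: y; exact: near_mx_norm_lt.
Unshelve. all: by end_near. Qed.

(** * Projection onto a convex set, and fixed points of contractions *)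

Section Projection.
Context {R : realType} {n : nat}.
Implicit Types (x y z s : 'rV[R]_n) (X : set 'rV[R]_n).

(** The variational form of the nearest point, kept as a relation: it is what the optimality of an
    update delivers directly. *)
Definition projects X z x : Prop :=
  X x /\ forall y, X y -> dot (z - x) (y - x) <= 0.

Lemma projects_exists X z : X !=set0 -> compact X -> convex_set X ->
  exists x, projects X z x.
Proof.
move=> X0 Xcpt Xcvx; pose f y := norm2 (y - z).
have f_lip x y : X x -> X y -> f x - f y <= 1 * norm2 (x - y).
  by move=> _ _; rewrite mul1r lerBlDr norm2B_trans.
have [x /set_mem Xx xmin] :=
  compact_EVT_min X0 Xcpt (lipschitz_within_continuous _ _ _ f_lip).
(* With zero step and direction, the quadratic objective is minus half the squared distance to
   [z]. *)
exists x; split => //; have := argmax_quadratic X 0 0 z x Xcvx.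
rewrite scaler0 addr0; apply; split => // y Xy.
rewrite !mul0r !add0r lerN2 ler_pM2l ?invr_gt0//.
rewrite ler_pXn2r ?nnegrE ?norm2_ge0//.
exact/xmin/mem_set.
Qed.

(** The two variational inequalities add up to [<z - z', x - x'> >= |x - x'|^2]; expanding
    [|(z - z') - (x - x')|^2 >= 0] then concludes. *)
Lemma projects_nonexpansive {X z z' x x'} :
  projects X z x -> projects X z' x' ->
  norm2 (x - x') ^+ 2 <= norm2 (z - z') ^+ 2.
Proof.
move=> [Xx hx] [Xx' hx']; have := hx _ Xx'; have := hx' _ Xx.
have := dot_ge0 ((z - z') - (x - x')).
rewrite !sqr_norm2 !dotE (dotC z' z) (dotC x' x) !(dotC x) !(dotC x').
lra.
Qed.

(** Compactness replaces iteration: the displacement [|x - S x|] has a minimiser [z], and passing to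
    [S z] multiplies its square by at most [rho < 1], so it vanishes at [z]. *)
Lemma contraction_fixpoint X (S : 'rV[R]_n -> 'rV[R]_n) (rho : R) :
  X !=set0 -> compact X -> rho < 1 ->
  (forall x, X x -> X (S x)) ->
  (forall x y, X x -> X y ->
     norm2 (S x - S y) ^+ 2 <= rho * norm2 (x - y) ^+ 2) ->
  exists2 z, X z & S z = z.
Proof.
move=> X0 Xcpt rho1 XS S_contr; pose f x := norm2 (x - S x).
have f_lip x y : X x -> X y -> f x - f y <= 2 * norm2 (x - y).
  move=> Xx Xy.
  have Sxy : norm2 (S x - S y) <= norm2 (x - y).
    rewrite -(ler_pXn2r (n := 2)) ?nnegrE ?norm2_ge0//.
    apply: le_trans (S_contr _ _ Xx Xy) _.
    by rewrite ler_piMl ?sqr_ge0// ltW.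
  have := norm2B_trans x y (S x); have := norm2B_trans y (S y) (S x).
  rewrite (norm2C (S y)) /f; lra.
have [z /set_mem Xz zmin] :=
  compact_EVT_min X0 Xcpt (lipschitz_within_continuous _ _ _ f_lip).
exists z => //; apply/esym/eqP; rewrite -subr_eq0; apply/eqP/norm2_eq0.
have := zmin _ (mem_set (XS _ Xz)).
rewrite -(ler_pXn2r (n := 2)) ?nnegrE ?norm2_ge0// /f => h.
have := le_trans h (S_contr _ _ Xz (XS _ Xz)).
rewrite -subr_ge0 -[X in _ - X]mul1r -mulrBl nmulr_rge0 ?subr_lt0// => h2.
by apply/eqP; rewrite -sqrf_eq0 eq_le h2 sqr_ge0.
Qed.

End Projection.

(** * Contraction and fixed points of the perturbed gradient step *)

Section PerturbedStep.
Context {R : realType} {n : nat}.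
Variables (X : set 'rV[R]_n) (V : 'rV[R]_n -> 'rV[R]_n) (L mu eta : R).
Hypotheses (X_nonempty : X !=set0) (X_compact : compact X)
  (X_convex : convex_set X) (V_monotone : monotone_game X V)
  (V_smooth : smooth_game X V L) (L_gt0 : 0 < L) (mu_gt0 : 0 < mu)
  (eta_gt0 : 0 < eta) (eta_lt : eta * (L + mu) ^+ 2 < mu).
Implicit Types x y z s : 'rV[R]_n.

Definition perturbed s x := V x - mu *: (x - s).

Lemma eta_mu_lt1 : eta * mu < 1.
Proof.
rewrite -(ltr_pM2l mu_gt0) mulr1; apply: le_lt_trans eta_lt.
have [L0 mu0] := (L_gt0, mu_gt0).
rewrite mulrCA ler_pM2l// -expr2 ler_sqr ?nnegrE; lra.
Qed.

(** Before projection the difference is [(1 - eta mu) d + eta w]. Monotonicity discards the cross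
    term and smoothness bounds [|w|] by [L |d|], leaving the factor [(1 - eta mu)^2 + eta^2 L^2],
    which is at most [1 - eta mu] because [eta (L^2 + mu^2) <= eta (L + mu)^2 < mu]. *)
Lemma step_contraction s x y x' y' : X x -> X y ->
  projects X (x + eta *: perturbed s x) x' ->
  projects X (y + eta *: perturbed s y) y' ->
  norm2 (x' - y') ^+ 2 <= (1 - eta * mu) * norm2 (x - y) ^+ 2.
Proof.
move=> Xx Xy Px Py; apply: le_trans (projects_nonexpansive Px Py) _.
pose d := x - y; pose w := V x - V y.
have -> : x + eta *: perturbed s x - (y + eta *: perturbed s y) =
    (1 - eta * mu) *: d + eta *: w.
  by apply/rowP => j; rewrite !mxE; ring.
have wd : dot w d <= 0 by apply: V_monotone.
have w2 : dot w w <= L ^+ 2 * dot d d.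
  rewrite -!sqr_norm2 -exprMn.
  rewrite ler_pXn2r ?nnegrE ?mulr_ge0 ?norm2_ge0 ?(ltW L_gt0)//.
  exact: V_smooth.
have d0 := dot_ge0 d; have mu_lt1 := eta_mu_lt1.
rewrite !sqr_norm2 -/d; move: wd w2 d0; clearbody d w => wd w2 d0.
rewrite !dotE (dotC d w).
have h1 : 0 <= eta * (1 - eta * mu) * - dot w d.
  by rewrite !mulr_ge0 ?oppr_ge0 ?subr_ge0// ltW.
have h2 : 0 <= eta ^+ 2 * (L ^+ 2 * dot d d - dot w w).
  by rewrite mulr_ge0 ?sqr_ge0 ?subr_ge0.
have h3 : 0 <= eta * (mu - eta * (L + mu) ^+ 2) * dot d d.
  by rewrite !mulr_ge0 ?subr_ge0 ?(ltW eta_lt) ?(ltW eta_gt0).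
have h4 : 0 <= eta ^+ 2 * (2 * L * mu) * dot d d.
  rewrite mulr_ge0// mulr_ge0 ?sqr_ge0// -mulrA mulr_ge0// mulr_ge0//.
    exact: ltW.
  exact: ltW.
lra.
Qed.

Lemma perturbed_fixpoint s :
  exists z, projects X (z + eta *: perturbed s z) z.
Proof.
have /choice[S SP] x :=
  projects_exists X (x + eta *: perturbed s x) X_nonempty X_compact X_convex.
have [|x _|x y Xx Xy|z Xz Sz] := @contraction_fixpoint _ _ X S
    (1 - eta * mu) X_nonempty X_compact.
- by rewrite gtrBl; exact: mulr_gt0.
- by case: (SP x).
- exact: step_contraction.
- by exists z; move: (SP z); rewrite Sz.
Qed.

(* With [g = s - z], the fixed point [z] is the resolvent of [- V / mu] at
   [s], so [g] is a value of a monotone operator at [z]. *)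
Lemma fixpoint_monotone s s' z z' :
  projects X (z + eta *: perturbed s z) z ->
  projects X (z' + eta *: perturbed s' z') z' ->
  0 <= dot ((s' - z') - (s - z)) (z' - z).
Proof.
move=> [Xz zP] [Xz' zP']; have := V_monotone _ _ Xz Xz'.
move: (zP _ Xz') (zP' _ Xz).
rewrite !(addrC _ (eta *: _)) !addrK !dotZl !pmulr_rle0// /perturbed.
move=> h h' hV; rewrite -(pmulr_rge0 _ mu_gt0).
by move: h h' hV; rewrite !dotE; lra.
Qed.

End PerturbedStep.

(** * Halpern's iteration with errors *)

Section Halpern.
Context {R : realType} {n : nat}.
Implicit Types (x y z g e : 'rV[R]_n).

(** Here [m] is [k + 1], the points [z], [z'] are taken relative to [x 1], and [e] is the error of
    the next anchor. Eliminating [z'] by the recurrence, the right side minus the left side is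
    exactly [m (m + 1) <g' - g, z' - z>] plus half of [|(m + 1) g' - m g|^2]. *)
Lemma halpern_potential_step (m : R) z z' g g' e : 0 < m ->
  (m + 1) *: (z' + g') = m *: (z + e) -> 0 <= dot (g' - g) (z' - z) ->
  2^-1 * (m + 1) ^+ 2 * dot g' g' + (m + 1) * dot g' z' <=
  2^-1 * m ^+ 2 * dot g g + m * dot g z + m * dot ((m + 1) *: g' - m *: g) e.
Proof.
move=> m0 rec mono.
have z'E : (m + 1) *: z' = m *: (z + e) - (m + 1) *: g'.
  by rewrite -rec scalerDr addrK.
have dzE : (m + 1) *: (z' - z) = m *: e - (m + 1) *: g' - z.
  by rewrite scalerBr z'E; apply/rowP => j; rewrite !mxE; ring.
have sq := dot_ge0 ((m + 1) *: g' - m *: g).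
have {}mono : 0 <= m * dot (g' - g) ((m + 1) *: (z' - z)).
  by rewrite dotZr mulr_ge0 ?(ltW m0)// mulr_ge0// ltW// ltr_wpDr.
rewrite -[(m + 1) * dot g' z']dotZr z'E.
move: mono sq; rewrite dzE !dotE (dotC g g').
lra.
Qed.

(* The sequence [x] is the Halpern iteration [x k.+1 = J (s k)] up to the error
   [delta], where [s k] averages [x k] with the starting point [x 1] and
   [z k = J (s k)]. *)
Lemma halpern_residual (x s z : nat -> 'rV[R]_n) (D delta : R) (K : nat) :
  0 <= D -> 0 <= delta -> 2 * K%:R ^+ 3 * delta <= D ->
  (forall k, k.+1%:R *: s k = k%:R *: x k + x 1%N) ->
  (forall k, (1 <= k < K)%N -> norm2 (x k.+1 - z k) <= delta) ->
  (forall k, (1 <= k <= K)%N ->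
    norm2 (s k - z k) <= D /\ norm2 (x 1%N - z k) <= D) ->
  (forall k, (1 <= k < K)%N ->
    0 <= dot ((s k.+1 - z k.+1) - (s k - z k)) (z k.+1 - z k)) ->
  forall k, (1 <= k <= K)%N -> k.+1%:R * norm2 (s k - z k) <= 3 * D.
Proof.
move=> D0 delta0 deltaK sE xz_le sz_le mono.
pose g k := s k - z k.
pose Phi k : R := 2^-1 * k.+1%:R ^+ 2 * dot (g k) (g k)
  + k.+1%:R * dot (g k) (z k - x 1%N).
have Phi_le k : (1 <= k <= K)%N -> Phi k <= 2 * k%:R ^+ 3 * (D * delta).
  elim: k => // k IH /andP[_ kK].
  have [->|k0] := posnP k.
    (* Base case: as [s 1 = x 1], the two terms of [Phi 1] cancel. *)
    have s1 : s 1%N = x 1%N.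
      apply: (@scalerI _ _ 2) => //.
      by rewrite sE -{2}(scale1r (x 1%N)) -scalerDl.
    rewrite /Phi /g s1 -(opprB (x 1%N)) dotNr.
    have -> : 2^-1 * 2 ^+ 2 * dot (x 1%N - z 1%N) (x 1%N - z 1%N) +
      2 * - dot (x 1%N - z 1%N) (x 1%N - z 1%N) = 0 :> R by field.
    by rewrite !mulr_ge0.
  have k1K : (1 <= k <= K)%N by rewrite k0 ltnW.
  have kltK : (1 <= k < K)%N by rewrite k0.
  have {}IH := IH k1K.
  have [gk_le _] := sz_le _ k1K; have [gk1_le _] := sz_le k.+1 kK.
  pose m : R := k.+1%:R; have m1E : k.+2%:R = m + 1 by rewrite -natr1.
  have m2 : 2 <= m by rewrite ler_nat.
  have m0 : 0 < m by lra.
  have rec : (m + 1) *: (z k.+1 - x 1%N + g k.+1) =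
      m *: (z k - x 1%N + (x k.+1 - z k)).
    rewrite -m1E [_ - _ + g _]addrC /g addrA subrK scalerBr sE.
    rewrite m1E scalerDl scale1r -/m.
    by apply/rowP => j; rewrite !mxE; ring.
  have dzE : z k.+1 - x 1%N - (z k - x 1%N) = z k.+1 - z k.
    by rewrite opprB addrA subrK.
  have := halpern_potential_step m _ _ (g k) _ _ m0 rec.
  rewrite dzE => /(_ (mono _ kltK)) step.
  have err : dot ((m + 1) *: g k.+1 - m *: g k) (x k.+1 - z k)
      <= (2 * m + 1) * (D * delta).
    have xz := xz_le _ kltK.
    have e_le u : norm2 u <= D -> dot u (x k.+1 - z k) <= D * delta.
      move=> uD; apply: le_trans (dot_le _ _) _.
      by rewrite ler_pM ?norm2_ge0.
    have e1 : dot (g k.+1) (x k.+1 - z k) <= D * delta := e_le _ gk1_le.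
    have e2 : - dot (g k) (x k.+1 - z k) <= D * delta.
      by rewrite -dotNl e_le ?norm2N.
    rewrite dotDl dotNl !dotZl.
    have := ler_wpM2l (ltW m0) e2; have m10 : 0 <= m + 1 by lra.
    have := ler_wpM2l m10 e1; lra.
  have Dd : 0 <= D * delta by rewrite mulr_ge0.
  rewrite /Phi m1E; apply: le_trans step _.
  have kE : k%:R = m - 1 :> R by rewrite /m -natr1 addrK.
  move: IH; rewrite /Phi -/m kE => IH.
  (* The step adds at most [m (2 m + 1) D delta], which for [m >= 2] is below the increment
     [2 (m^3 - (m - 1)^3) D delta] of the claimed bound. *)
  have := ler_wpM2l (ltW m0) err.
  nra.
move=> k kK; have [_ zx_le] := sz_le _ kK.
have := Phi_le _ kK; rewrite /Phi -sqr_norm2 -/(g k).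
set u := norm2 (g k); set m : R := k.+1%:R.
have u0 : 0 <= u := norm2_ge0 _.
have m0 : 0 < m by rewrite ltr0n.
have gz := le_trans (dot_le (g k) (x 1%N - z k)) (ler_wpM2l u0 zx_le).
have {}gz : - (m * dot (g k) (z k - x 1%N)) <= m * u * D.
  by rewrite -mulrN -dotNr opprB -mulrA ler_pM2l.
have kd : 2 * k%:R ^+ 3 * (D * delta) <= D * D.
  rewrite mulrCA ler_wpM2l// (le_trans _ deltaK)// ler_wpM2r// ler_pM2l//.
  by rewrite lerXn2r ?nnegrE// ler_nat; case/andP: kK.
(* For [w = m u] this reads [w^2 <= 2 w D + 2 D^2], whereas [w > 3 D] would make
   [(w - 3 D) (w + D) = w^2 - 2 w D - 3 D^2] positive. *)
move=> h; have : 2^-1 * (m * u) ^+ 2 <= m * u * D + D * D.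
  by rewrite exprMn mulrA; lra.
have mu0 : 0 <= m * u by rewrite mulr_ge0// ltW.
move: (m * u) mu0 => w w0 hw; rewrite leNgt; apply/negP => wD.
have : 0 < (w - 3 * D) * (w + D) by rewrite mulr_gt0; lra.
nra.
Qed.



End Halpern.

(** * Diameter, gap function and tangent residual *)

Section Gap.
Context {R : realType} {n : nat}.
Implicit Types (x y p a : 'rV[R]_n) (X : set 'rV[R]_n).

Lemma compact_norm_le X : compact X -> exists M : R, forall x, X x -> `|x| <= M.
Proof.
move=> /compact_bounded[M [_ XM]]; exists (M + 1) => x Xx.
by apply: XM => //; rewrite ltrDl.
Qed.

Lemma norm2_le_diameter X x y : compact X -> X x -> X y ->
  norm2 (x - y) <= diameter X.
Proof.
move=> /compact_norm_le[M XM] Xx Xy; apply: ub_le_sup; last by exists x, y.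
exists (n%:R * (M + M)) => _ [x' [y' [Xx' Xy' ->]]].
apply: le_trans (norm2_le_mx_norm _) _; rewrite ler_wpM2l//.
by apply: le_trans (ler_normB _ _) _; rewrite lerD ?XM.
Qed.

Lemma rtan_le X V p a : normal_cone X p a -> rtan X V p <= norm2 (- V p + a).
Proof.
move=> aN; apply: ge_inf; last by exists a.
by exists 0 => _ [b _ <-]; exact: norm2_ge0.
Qed.

(** For a normal vector [a], [<V p, q - p> <= <V p - a, q - p>], and Cauchy-Schwarz bounds the
    latter by [D |V p - a|]; it remains to take the infimum over [a]. *)
Lemma gap_le_rtan X V p : compact X -> X p ->
  gap X V p <= diameter X * rtan X V p.
Proof.
move=> Xcpt Xp; set D := diameter X.
have D0 : 0 <= D.
  exact: le_trans (norm2_ge0 _) (norm2_le_diameter _ _ _ Xcpt Xp Xp).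
have gap_le a : normal_cone X p a -> gap X V p <= D * norm2 (- V p + a).
  move=> aN; apply: ge_sup; first by exists (dot (V p) (p - p)), p.
  move=> _ [q Xq <-]; rewrite mulrC.
  have -> : dot (V p) (q - p) = dot (V p - a) (q - p) + dot a (q - p).
    by rewrite -dotDl subrK.
  rewrite -[leRHS]addr0 lerD ?aN//.
  apply: le_trans (dot_le _ _) _; rewrite norm2C addrC.
  by rewrite ler_wpM2l ?norm2_ge0// norm2_le_diameter.
have N0 : normal_cone X p 0 by move=> q _; rewrite -(scale0r 0) dotZl mul0r.
(* Passing to the infimum divides by [D], so a one-point set is treated apart, with the normal
   vector 0. *)
have [D_eq0|D_neq0] := eqVneq D 0.
  by have := gap_le _ N0; rewrite D_eq0 !mul0r.
have D_gt0 : 0 < D by rewrite lt_def D_neq0.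
rewrite mulrC -ler_pdivrMr//; apply: lb_le_inf.
  by exists (norm2 (- V p + 0)), 0.
by move=> _ [a aN <-]; rewrite ler_pdivrMr// mulrC gap_le.
Qed.

End Gap.

(** * From the players' blocks to the product space *)

Section Blocks.
Context {R : realType} {N : nat} {d : 'I_N -> nat}.
Local Notation profile := 'rV[R]_(\sum_i d i).
Implicit Types (p q : profile) (X : forall i, set 'rV[R]_(d i)).

Lemma dot_blocks p q : dot p q = \sum_i dot (submxrow p i) (submxrow q i).
Proof.
rewrite /dot sig_big_dep/= (reindex _ tagnat.sig_bij_on)/=.
apply: eq_bigr => l _.
by rewrite !mxE -/(tagnat.sig1 l) -/(tagnat.sig2 l) tagnat.sig2K.
Qed.

Lemma submxrowZ (k : R) p i : submxrow (k *: p) i = k *: submxrow p i.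
Proof. by apply/rowP => j; rewrite !mxE. Qed.

Lemma norm_submxrow p i : `|submxrow p i| <= `|p|.
Proof. by apply: mx_norm_le => // j; rewrite mxE mx_norm_coord. Qed.

Lemma submxrow_continuous i :
  continuous ((fun p => submxrow p i) : profile -> 'rV[R]_(d i)).
Proof.
by apply: nonexpansive_continuous => p q; rewrite -submxrowB norm_submxrow.
Qed.

Lemma profiles_compact X : (forall i, compact (X i)) -> compact (profiles X).
Proof.
move=> Xcpt; apply: bounded_closed_compact.
  have /choice[M XM] i := compact_norm_le _ (Xcpt i).
  exists (\sum_i `|M i|); split=> [|B /ltW MB p Xp]; first exact: num_real.
  apply: le_trans MB; apply: mx_norm_le.
    by apply: sumr_ge0.
  move=> j; rewrite -(tagnat.sig2K j).
  have -> : p 0 (tagnat.Rank (tagnat.sig1 j) (tagnat.sig2 j)) =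
    submxrow p (tagnat.sig1 j) 0 (tagnat.sig2 j) by rewrite mxE.
  apply: le_trans (mx_norm_coord _ _) _; apply: le_trans (XM _ _ (Xp _)) _.
  rewrite (bigD1 (tagnat.sig1 j))//=; apply: le_trans (ler_norm _) _.
  by rewrite lerDl sumr_ge0.
have -> : profiles X = \bigcap_(i in setT) (fun p => submxrow p i) @^-1` X i.
  by apply/seteqP; split => [p Xp i _|p Xp i]; [exact: Xp | exact: Xp].
apply: closed_bigI => i _; apply: preimage_closed.
  by move=> p _; exact: submxrow_continuous.
by apply: compact_closed => //; exact: norm_hausdorff.
Qed.

Lemma profiles_convex X :
  (forall i, convex_set (X i)) -> convex_set (profiles X).
Proof.
move=> Xcvx p q t /set_mem Xp /set_mem Xq; apply/mem_set => i.
have /set_mem := Xcvx i _ _ t (mem_set (Xp i)) (mem_set (Xq i)).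
by congr (X i); apply/rowP => j; rewrite !mxE.
Qed.

(** The point [s_k]: the two perturbation terms of the update sum to [mu (p t - s_k)], a single pull
    towards it. *)
Definition average (Ts : nat) (p : nat -> profile) (k : nat) : profile :=
  k.+1%:R^-1 *: (k%:R *: anchor Ts p k + anchor Ts p 1).

(** The inner product splits over blocks, so the players' optimality conditions sum to the
    variational inequality of one joint projection. *)
Lemma gabp_projects X V (eta mu : R) Ts T (p : nat -> profile) t :
  (forall i, convex_set (X i)) ->
  gabp X (fun=> eta) mu Ts T (fun t => V (p t)) p -> (1 <= t <= T)%N ->
  projects (profiles X)
    (p t + eta *: perturbed V mu (average Ts p (phase Ts t)) (p t)) (p t.+1).
Proof.
move=> Xcvx [_ step] tT; split=> [i|q Xq]; first by case: (step t tT i).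
rewrite dot_blocks; apply: sumr_le0 => i _.
have /= := argmax_quadratic _ _ _ _ _ (Xcvx i) (step t tT i) _ (Xq i).
set k := phase Ts t.
congr (_ <= 0); rewrite !submxrowB !submxrowD !submxrowZ; congr dot.
congr (_ + _ *: _ - _); rewrite /perturbed /average.
have k1 : k.+1%:R != 0 :> R by rewrite pnatr_eq0.
rewrite !(submxrowB, submxrowD, submxrowZ).
apply/rowP => j; rewrite !mxE -natr1; field.
by rewrite natr1.
Qed.

End Blocks.

(** * Index arithmetic of the phases *)

Lemma phase_bounds (Ts t : nat) : (0 < Ts)%N -> (0 < t)%N ->
  (Ts * (phase Ts t - 1) < t <= Ts * phase Ts t)%N.
Proof.
move=> Ts0 t0; rewrite /phase; have := divn_eq (t - 1) Ts.
have := ltn_pmod (t - 1) Ts0.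
move: (_ %/ _)%N (_ %% _)%N => a b; rewrite addnK mulnDr muln1 (mulnC Ts a).
lia.
Qed.

Lemma phase_shift (Ts k j : nat) : (0 < k)%N -> (j < Ts)%N ->
  phase Ts (Ts * (k - 1) + 1 + j) = k.
Proof.
move=> k0 jT; rewrite /phase.
rewrite addnAC addnK mulnC.
by rewrite divnMDl ?(leq_ltn_trans _ jT)// divn_small// addn0 subnK.
Qed.

(** * Convergence rate of the iterates and of the tangent residual *)

Section Rate.
Context {R : realType} {N : nat} {d : 'I_N -> nat}.
Local Notation profile := 'rV[R]_(\sum_i d i).
Variables (X : set profile) (V : profile -> profile) (L mu eta : R)
  (T Ts : nat) (p : nat -> profile).
Hypotheses (X_compact : compact X)
  (X_convex : convex_set X) (V_monotone : monotone_game X V)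
  (V_smooth : smooth_game X V L) (L_gt0 : 0 < L) (mu_gt0 : 0 < mu)
  (eta_gt0 : 0 < eta) (eta_lt : eta * (L + mu) ^+ 2 < mu)
  (Ts_gt0 : (0 < Ts)%N)
  (Ts_large : (3 * T.+1%:R) ^+ 6 * (1 - eta * mu) ^+ Ts <= 1)
  (p1_in : X (p 1%N))
  (p_step : forall t, (1 <= t <= T)%N ->
    projects X (p t + eta *: perturbed V mu (average Ts p (phase Ts t)) (p t))
      (p t.+1)).
Local Notation D := (diameter X).
Local Notation x := (anchor Ts p).
Local Notation s := (average Ts p).

Lemma iterate_in t : (1 <= t <= T.+1)%N -> X (p t).
Proof.
move=> tT; have [->|t1] := eqVneq t 1%N; first exact: p1_in.
have -> : t = t.-1.+1 by lia.
by have [] := p_step t.-1 ltac:(lia).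
Qed.

Lemma average_in k : X (x k) -> X (s k).
Proof.
move=> Xk; have X1 : X (x 1%N) by rewrite /anchor subnn muln0.
have -> : s k = x k + k.+1%:R^-1 *: (x 1%N - x k).
  have k1 : k.+1%:R != 0 :> R by rewrite pnatr_eq0.
  rewrite /average; apply/rowP => j; rewrite !mxE -natr1; field.
  by rewrite natr1.
by apply: convex_segment; rewrite // invr_ge0 ler0n invf_le1 ?ler1n ?ltr0n.
Qed.

(** [z] is fixed by every step of phase [k], so each one contracts the distance to it. The case
    [j = Ts] is included: the last step of the phase lands on the next anchor. *)
Lemma iterate_rate z k j : (0 < k)%N -> (Ts * (k - 1) + j <= T)%N ->
  (j <= Ts)%N -> projects X (z + eta *: perturbed V mu (s k) z) z ->
  norm2 (p (Ts * (k - 1) + 1 + j)%N - z) ^+ 2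
    <= (1 - eta * mu) ^+ j * norm2 (x k - z) ^+ 2.
Proof.
move=> k0 + + zP; elim: j => [|j IH] jT jTs.
  by rewrite addn0 expr0 mul1r.
have tT : (1 <= Ts * (k - 1) + 1 + j <= T)%N.
  by move: (Ts * (k - 1))%N jT => a; lia.
have step := p_step _ tT.
rewrite phase_shift// in step.
rewrite [X in X * _]exprS -mulrA addnS.
have Xp : X (p (Ts * (k - 1) + 1 + j)%N).
  by apply: iterate_in; case/andP: tT => -> /leqW.
have Xz : X z by case: zP.
apply: le_trans (step_contraction X V L mu eta V_monotone V_smooth L_gt0 mu_gt0
  eta_gt0 eta_lt _ _ _ _ _ Xp Xz step zP) _.
rewrite ler_wpM2l//.
  by rewrite subr_ge0 (ltW (eta_mu_lt1 L mu eta L_gt0 mu_gt0 eta_gt0 eta_lt)).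
by apply: IH; [apply: leq_trans jT; rewrite leq_add2l | exact: ltnW].
Qed.

Lemma phase_le k : (0 < k <= phase Ts T)%N -> (Ts * (k - 1) <= T)%N.
Proof.
rewrite /phase addnC => /andP[_ kT].
apply: leq_trans (leq_mul (leqnn Ts) _) (leq_trans _ (leq_subr 1 T)).
  by rewrite leq_subLR; exact: kT.
by rewrite mulnC leq_trunc_div.
Qed.

Lemma anchor_in k : (0 < k <= phase Ts T)%N -> X (x k).
Proof. by move=> kT; apply: iterate_in; rewrite addn1 /= ltnS phase_le. Qed.

Lemma anchor_fixpoint_dist z :
  (forall k, projects X (z k + eta *: perturbed V mu (s k) (z k)) (z k)) ->
  forall k, (1 <= k <= phase Ts T)%N ->
  k.+1%:R * norm2 (s k - z k) <= 3 * D /\ k.+1%:R * norm2 (x k - z k) <= 4 * D.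
Proof.
move=> zP; set K := phase Ts T; set B : R := 3 * T.+1%:R.
have Xz k : X (z k) by case: (zP k).
have le_D a b : X a -> X b -> norm2 (a - b) <= D.
  exact: norm2_le_diameter.
have D0 : 0 <= D := le_trans (norm2_ge0 _) (le_D _ _ p1_in p1_in).
have B0 : 0 < B by rewrite mulr_gt0.
have X1 : X (x 1%N) by rewrite /anchor subnn muln0.
have s_le : forall k, (1 <= k <= K)%N -> k.+1%:R * norm2 (s k - z k) <= 3 * D.
  (* By [Ts_large] a complete phase shrinks a squared distance [D^2] to at most [D^2 / B^6], whence
     the error [D / B^3]; it satisfies the smallness condition because [K <= T + 1] and
     [B^3 = 27 (T + 1)^3]. *)
  apply: (halpern_residual x s z D (D / B ^+ 3)) => //.
  - by rewrite divr_ge0// exprn_ge0// ltW.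
  - rewrite mulrCA ler_piMr// ler_pdivrMr ?exprn_gt0// mul1r.
    apply: (@le_trans _ _ (2 * T.+1%:R ^+ 3)).
      rewrite ler_pM2l// lerXn2r ?nnegrE// ler_nat /K /phase addn1 ltnS.
      by rewrite (leq_trans (leq_div _ _))// leq_subr.
    rewrite /B exprMn ler_wpM2r ?exprn_ge0//; lra.
  - by move=> k; rewrite /average scalerA mulfV ?pnatr_eq0// scale1r.
  - move=> k /andP[k0 kK].
    have xk1 : x k.+1 = p (Ts * (k - 1) + 1 + Ts)%N.
      rewrite /anchor subn1/= addnAC; congr (p (_ + 1)%N).
      by rewrite -{1}(subnK k0) mulnDr muln1.
    rewrite xk1 -(ler_pXn2r (n := 2)) ?nnegrE ?norm2_ge0//; last first.
      by rewrite divr_ge0// exprn_ge0// ltW.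
    have kT : (Ts * (k - 1) + Ts <= T)%N.
      have := @phase_le k.+1; rewrite subn1/= => /(_ kK); apply: leq_trans.
      by rewrite -{2}(subnK k0) mulnDr muln1.
    apply: le_trans (iterate_rate _ _ _ k0 kT (leqnn _) (zP k)) _.
    have Xk : X (x k) by apply: anchor_in; rewrite k0 ltnW.
    have xz2 : norm2 (x k - z k) ^+ 2 <= D ^+ 2.
      by rewrite lerXn2r ?nnegrE ?norm2_ge0// le_D.
    rewrite expr_div_n -exprM ler_pdivlMr ?exprn_gt0//.
    have w0 : 0 <= 1 - eta * mu.
      rewrite subr_ge0 ltW//.
      exact: (eta_mu_lt1 L mu eta L_gt0 mu_gt0 eta_gt0 eta_lt).
    have -> : forall a b c : R, a * b * c = c * a * b by move=> a b c; ring.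
    rewrite -[leRHS]mul1r ler_pM//.
      by rewrite mulr_ge0 ?exprn_ge0 ?(ltW B0).
    by rewrite sqr_ge0.
  - move=> k kK; have Xk := anchor_in _ kK.
    by split; apply: le_D => //; exact: average_in.
  - move=> k _.
    exact: (fixpoint_monotone X V mu eta).
move=> k kK; split; first exact: s_le.
have Xk := anchor_in _ kK.
(* Since [x k - s k = (x k - x 1) / (k + 1)], replacing [s k] by [x k] costs one more [D]. *)
apply: le_trans (ler_wpM2l (ler0n _ _) (norm2B_trans (x k) (s k) (z k))) _.
have k1 : k.+1%:R != 0 :> R by rewrite pnatr_eq0.
have -> : x k - s k = k.+1%:R^-1 *: (x k - x 1%N).
  rewrite /average; apply/rowP => j; rewrite !mxE -natr1; field.
  by rewrite natr1.
rewrite mulrDr norm2Z ?invr_ge0// mulVKf//.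
have := s_le k kK; have := le_D _ _ Xk X1; lra.
Qed.

Lemma rtan_rate t : (1 <= t <= T)%N ->
  rtan X V (p t.+1) <= 8 * D / (phase Ts t)%:R * (mu + (1 + eta * L) / eta).
Proof.
move=> tT; have [t0 tleT] := andP tT.
have X_nonempty : X !=set0 by exists (p 1%N).
have /choice[z zP] k := perturbed_fixpoint X V L mu eta X_nonempty X_compact
  X_convex V_monotone V_smooth L_gt0 mu_gt0 eta_gt0 eta_lt (s k).
set k := phase Ts t; pose m : R := k.+1%:R.
have k0 : (0 < k)%N by rewrite /k /phase addn1.
have kK : (1 <= k <= phase Ts T)%N.
  by rewrite k0 /k /phase leq_add2r leq_div2r// leq_sub2r.
have [s_le x_le] := anchor_fixpoint_dist z zP k kK.
have /andP[t_gt t_le] := phase_bounds Ts t Ts_gt0 t0.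
have m0 : 0 < m by rewrite ltr0n.
have D0 : 0 <= D.
  exact: le_trans (norm2_ge0 _) (norm2_le_diameter _ _ _ X_compact p1_in p1_in).
have near_z j : (j <= Ts)%N -> (Ts * (k - 1) + j <= T)%N ->
    m * norm2 (p (Ts * (k - 1) + 1 + j)%N - z k) <= 4 * D.
  move=> jTs jT; apply: le_trans x_le; rewrite ler_pM2l//.
  rewrite -(ler_pXn2r (n := 2)) ?nnegrE ?norm2_ge0//.
  apply: le_trans (iterate_rate _ _ _ k0 jT jTs (zP k)) _.
  rewrite ler_piMl ?sqr_ge0//.
  have := eta_mu_lt1 L mu eta L_gt0 mu_gt0 eta_gt0 eta_lt.
  rewrite -subr_gt0 => h; rewrite exprn_ile1 ?(ltW h)//.
  by rewrite gerBl ltW// mulr_gt0.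
(* Both ends of step [t] are reached from the anchor of the same phase [k], after
   [t - 1 - Ts (k - 1)] steps and one more. *)
have [tz t1z] : m * norm2 (p t - z k) <= 4 * D /\
    m * norm2 (p t.+1 - z k) <= 4 * D.
  have kTs : (Ts * k = Ts * (k - 1) + Ts)%N.
    by rewrite -{1}(subnK k0) mulnDr muln1.
  have := near_z (t - 1 - Ts * (k - 1))%N; have := near_z (t - Ts * (k - 1))%N.
  rewrite -/k kTs in t_le t_gt *.
  move: (Ts * (k - 1))%N t_gt t_le => a t_gt t_le.
  have -> : (a + 1 + (t - a) = t.+1)%N by lia.
  have -> : (a + 1 + (t - 1 - a) = t)%N by lia.
  by move=> h1 h2; split; [apply: h2; lia | apply: h1; lia].
have [_ step] := p_step t tT.
(* The projection residual of step [t] divided by [eta]; it is normal at [p t.+1] by the variational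
   inequality. *)
pose a := eta^-1 *: (p t - p t.+1) + perturbed V mu (s k) (p t).
have aN : normal_cone X (p t.+1) a.
  move=> q Xq; rewrite -(pmulr_rle0 _ eta_gt0) -dotZl.
  have -> : eta *: a = p t + eta *: perturbed V mu (s k) (p t) - p t.+1.
    by rewrite scalerDr scalerA mulfV ?gt_eqF// scale1r addrAC.
  exact: step.
apply: le_trans (rtan_le _ _ _ _ aN) _.
have Xt : X (p t) by apply: iterate_in; rewrite t0 leqW.
have Xt1 : X (p t.+1) by apply: iterate_in.
have aE : - V (p t.+1) + a = (V (p t) - V (p t.+1)) +
    (eta^-1 *: (p t - p t.+1) + mu *: (s k - p t)).
  by rewrite /a /perturbed; apply/rowP => j; rewrite !mxE; ring.
have norm_le : norm2 (- V (p t.+1) + a) <=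
    (L + eta^-1) * norm2 (p t - p t.+1) + mu * norm2 (s k - p t).
  rewrite aE; apply: le_trans (norm2D _ _) _; rewrite mulrDl -addrA lerD//.
    exact: V_smooth.
  apply: le_trans (norm2D _ _) _.
  by rewrite !norm2Z ?invr_ge0 ?(ltW eta_gt0) ?(ltW mu_gt0).
(* Both distances go through [z k]: the bounds are [4 D + 4 D] here and [3 D + 4 D] for [sp]. *)
have pp : m * norm2 (p t - p t.+1) <= 8 * D.
  have := ler_wpM2l (ltW m0) (norm2B_trans (p t) (z k) (p t.+1)).
  rewrite (norm2C (z k)); lra.
have sp : m * norm2 (s k - p t) <= 8 * D.
  have := ler_wpM2l (ltW m0) (norm2B_trans (s k) (z k) (p t)).
  rewrite (norm2C (z k)) -/m in s_le *; lra.
have km : k%:R <= m by rewrite ler_nat.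
have kR0 : 0 < k%:R :> R by rewrite ltr0n.
apply: le_trans norm_le _.
have -> : mu + (1 + eta * L) / eta = (L + eta^-1) + mu.
  by field; rewrite gt_eqF.
have scale u : m * u <= 8 * D -> 0 <= u -> u <= 8 * D / k%:R.
  move=> mu_le u0; rewrite ler_pdivlMr// mulrC (le_trans _ mu_le)//.
  by rewrite ler_wpM2r.
rewrite mulrDr [leRHS]addrC [leRHS]addrC lerD//.
  rewrite mulrC ler_wpM2r ?addr_ge0 ?invr_ge0 ?(ltW eta_gt0) ?(ltW L_gt0)//.
  by rewrite scale// norm2_ge0.
by rewrite mulrC ler_wpM2r ?(ltW mu_gt0)// scale// norm2_ge0.
Qed.

End Rate.

(** * From the update interval to the final bound *)

Theorem theorem4p1 (R : realType) (N : nat) (d : 'I_N -> nat)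
    (X : forall i : 'I_N, set 'rV[R]_(d i))
    (v : 'I_N -> 'rV[R]_(\sum_i d i) -> R)
    (V : 'rV[R]_(\sum_i d i) -> 'rV[R]_(\sum_i d i))
    (L mu eta c : R) (T Ts : nat) (p : nat -> 'rV[R]_(\sum_i d i))
    (X_nonempty : forall i, X i !=set0)
    (X_compact : forall i, compact (X i))
    (X_convex : forall i, convex_set (X i))
    (V_gradient : gradient_operator X v V)
    (V_monotone : monotone_game (profiles X) V)
    (L_gt0 : 0 < L)
    (V_smooth : smooth_game (profiles X) V L)
    (T_ge1 : (1 <= T)%N)
    (mu_gt0 : 0 < mu)
    (eta_gt0 : 0 < eta)
    (eta_lt : eta < mu / (L + mu) ^+ 2)
    (c_ge1 : 1 <= c)
    (Ts_def : Ts%:R =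
      c * Num.max 1 (6 * ln (3 * T.+1%:R) / ln (1 + eta * mu)))
    (p_gabp : gabp X (fun=> eta) mu Ts T (fun t => V (p t)) p) :
  let D := diameter (profiles X) in
  forall t : nat, (1 <= t <= T)%N ->
    gap (profiles X) V (p t.+1) <= D * rtan (profiles X) V (p t.+1) /\
    D * rtan (profiles X) V (p t.+1) <=
      17 * c * D ^+ 2 * (6 * ln (3 * T.+1%:R) / ln (1 + eta * mu) + 1) / t%:R
      * (mu + (1 + eta * L) / eta).
Proof.
move=> D t tT.
have Xcpt := profiles_compact X X_compact.
have Xcvx := profiles_convex X X_convex.
have eta_lt' : eta * (L + mu) ^+ 2 < mu.
  by rewrite -ltr_pdivlMr// exprn_gt0// addr_gt0.
have c0 : 0 < c := lt_le_trans ltr01 c_ge1.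
set B := 3 * T.+1%:R in Ts_def *; set a := eta * mu in Ts_def *.
have a0 : 0 < a by rewrite mulr_gt0.
have a1 : a < 1 := eta_mu_lt1 L mu eta L_gt0 mu_gt0 eta_gt0 eta_lt'.
have B1 : 1 <= B by rewrite /B -natrM ler1n.
have B0 : 0 < B := lt_le_trans ltr01 B1.
have ln_a : 0 < ln (1 + a) by rewrite ln_gt0// ltrDl.
set l := 6 * ln B / ln (1 + a) in Ts_def *.
have l0 : 0 <= l by rewrite divr_ge0 ?(ltW ln_a)// mulr_ge0// ln_ge0.
have Ts_ge : Num.max 1 l <= Ts%:R by rewrite Ts_def ler_peMl// le_max ler01.
move: Ts_ge; rewrite ge_max => /andP[Ts1 Tsl].
have Ts0 : (0 < Ts)%N by rewrite -(ltr0n R) (lt_le_trans ltr01).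
(* [Ts >= l] says that [(1 + a)^Ts >= B^6], and [(1 + a) (1 - a) <= 1] turns this growth into
   decay. *)
have Ts_large : B ^+ 6 * (1 - a) ^+ Ts <= 1.
  have B_le : B ^+ 6 <= (1 + a) ^+ Ts.
    rewrite -ler_ln ?posrE ?exprn_gt0//; last by rewrite addr_gt0.
    rewrite !lnXn//; last by rewrite addr_gt0.
    by rewrite -[leLHS]mulr_natl -[leRHS]mulr_natl -ler_pdivrMr.
  apply: (@le_trans _ _ ((1 + a) ^+ Ts * (1 - a) ^+ Ts)).
    by rewrite ler_wpM2r// exprn_ge0// subr_ge0 ltW.
  rewrite -exprMn exprn_ile1//; nra.
have p1 : profiles X (p 1%N) by case: p_gabp.
have pstep t' : _ := @gabp_projects _ _ _ X V eta mu Ts T p t' X_convex p_gabp.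
have D0 : 0 <= D.
  exact: le_trans (norm2_ge0 _) (norm2_le_diameter _ _ _ Xcpt p1 p1).
split.
  apply: gap_le_rtan => //.
  by have [] := pstep t tT.
have rate := rtan_rate _ _ _ _ _ _ _ _ Xcpt Xcvx V_monotone V_smooth L_gt0
  mu_gt0 eta_gt0 eta_lt' Ts0 Ts_large p1 pstep t tT.
apply: le_trans (ler_wpM2l D0 rate) _.
set M := mu + _; have M0 : 0 <= M.
  rewrite addr_ge0 ?(ltW mu_gt0)// divr_ge0 ?(ltW eta_gt0)// addr_ge0//.
  by rewrite ltW// mulr_gt0.
rewrite mulrA ler_wpM2r//.
have [t0 _] := andP tT.
have /andP[_ t_le] := phase_bounds Ts t Ts0 t0.
set k := phase Ts t in t_le *.
have k0 : (0 < k)%N by rewrite /k /phase addn1.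
(* Phase [k] ends at [Ts k], and [max(1, l) <= l + 1]: this converts [1 / k] into [1 / t]. *)
have {}t_le : t%:R <= c * (l + 1) * k%:R :> R.
  apply: (@le_trans _ _ (Ts%:R * k%:R)); first by rewrite -natrM ler_nat.
  rewrite ler_wpM2r// Ts_def ler_pM2l// ge_max; lra.
rewrite ler_pdivlMr ?ltr0n// -/D.
have -> : D * (8 * D / k%:R) * t%:R = 8 * D * D * t%:R / k%:R by ring.
rewrite ler_pdivrMr ?ltr0n//.
(* The constant reached is 8, within the stated 17. *)
have := ler_wpM2l (mulr_ge0 D0 D0) t_le.
have : 0 <= D * D * (c * (l + 1) * k%:R).
  by rewrite !mulr_ge0// ?(ltW c0)// addr_ge0.
lra.
Qed.
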